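(* Let $\beta>0$ and $w\in(-\infty,\infty]$. Suppose that $$\limsup_{t\to0}\mathbf{Var}\big[\mathrm{Tr}[e^{-tH_{\beta,w}}]\big]<\infty,$$ and that for every fixed $u>0$, $$\lim_{t\to0}\mathbf{Cov}\big[\mathrm{Tr}[e^{-tH_{\beta,w}}],\mathrm{Tr}[e^{-uH_{\beta,w}}]\big]=0$$ (limits as $t\to0$ with $t>0$). Then for every Borel set $B\subset\mathbb R$ that is bounded above, there exists a deterministic measurable function $F_B:\mathcal N^\#_{B^c}\to\mathbb R$ such that $\Pi_{\beta,w}(B)=F_B\big(\Pi_{\beta,w}|_{B^c}\big)$ almost surely, where $\Pi_{\beta,w}$ is the eigenvalue point process of the stochastic Airy operator $H_{\beta,w}$.
   Context: **Stochastic Airy operator.** Let $W$ be a standard Brownian motion on $[0,\infty)$ with $W(0)=0$. For $\beta>0$ and $\phi:[0,\infty)\to\mathbb R$ continuous and compactly supported, let $\xi_\beta(\phi):=\frac{2}{\sqrt\beta}\int_0^\infty\phi(x)\,\mathrm dW(x)$; for smooth compactly supported $\phi$ this is understood pathwise through integration by parts, $\xi_\beta(\phi)=-\frac2{\sqrt\beta}\int_0^\infty\phi'(x)W(x)\,\mathrm dx$. Let $V(x)=x$, let $\|\cdot\|_2$ be the norm of $L^2([0,\infty))$, and let $\|f\|_*^2:=\|f'\|_2^2+\|V^{1/2}f\|_2^2+\|f\|_2^2$. Let $C_0^\infty([0,\infty))$ be the set of smooth compactly supported functions $[0,\infty)\to\mathbb R$ (not required to vanish at $0$). For $w\in(-\infty,\infty]$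 define the form core $\mathrm{FC}_{\beta,w}:=C_0^\infty([0,\infty))$ if $w<\infty$, and $\mathrm{FC}_{\beta,w}:=\{\phi\in C_0^\infty([0,\infty)):\phi(0)=0\}$ if $w=\infty$. For $\phi\in\mathrm{FC}_{\beta,w}$ define $$\mathcal E_{\beta,w}(\phi):=\begin{cases}w\,\phi(0)^2+\|\phi'\|_2^2+\|V^{1/2}\phi\|_2^2+\xi_\beta(\phi^2)&\text{if }w<\infty,\\ \|\phi'\|_2^2+\|V^{1/2}\phi\|_2^2+\xi_\beta(\phi^2)&\text{if }w=\infty.\end{cases}$$ It is a known theorem (may be assumed) that, almost surely, $\mathcal E_{\beta,w}$ extends continuously with respect to $\|\cdot\|_*$ to a domain $D(\mathcal E_{\beta,w})$ (the $\|\cdot\|_*$-closure of $\mathrm{FC}_{\beta,w}$) on which it is closed and semibounded, and that the unique self-adjoint operator $H_{\beta,w}$ on $L^2([0,\infty))$ with this quadratic form has compact resolvent. Formally, $H_{\beta,w}f(x)=-f''(x)+\big(x+\frac2{\sqrt\beta}W'(x)\big)f(x)$ with boundary condition $f'(0)=wf(0)$ if $w<\infty$ and $f(0)=0$ if $w=\infty$. Consequently, almost surely, its spectrum consists of eigenvalues $-\infty<\Lambda_{\beta,w}(1)\le\Lambda_{\beta,w}(2)\le\cdots$ (with multiplicity), bounded below and without accumulation point. **Point processes.** For a Borel set $A\subset\mathbb R$ with Borel $\sigma$-algebra $\mathcal B_A$, $\mathcal N^\#_A$ is the set of integer-valued measures $\mu$ on $(A,\mathcal B_A)$ with $\mu(K)<\infty$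 for every bounded (Borel) $K\subset A$, equipped with the topology generated by the maps $\mu\mapsto\int_A f\,\mathrm d\mu$, for $f:\mathbb R\to\mathbb R$ continuous and compactly supported, and the associated Borel $\sigma$-algebra. The eigenvalue point process is $\Pi_{\beta,w}:=\sum_{k\ge1}\delta_{\Lambda_{\beta,w}(k)}\in\mathcal N^\#_{\mathbb R}$, and for Borel $A\subset\mathbb R$ its restriction is $\Pi_{\beta,w}|_{A^c}:=\sum_{k\ge1}\mathbf 1_{\{\Lambda_{\beta,w}(k)\in A^c\}}\delta_{\Lambda_{\beta,w}(k)}\in\mathcal N^\#_{A^c}$. **Traces.** For $t>0$, $\mathrm{Tr}[e^{-tH_{\beta,w}}]=\sum_{k\ge1}e^{-t\Lambda_{\beta,w}(k)}=\int_{\mathbb R}e^{-tx}\,\mathrm d\Pi_{\beta,w}(x)$. Variances and covariances are taken with respect to the randomness of $W$. A Borel set $B\subset\mathbb R$ is *bounded above* if $B\subset(-\infty,c]$ for some $c\in\mathbb R$. *)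

(* Defs.v *)
(* MathComp / MathComp-Analysis, over an abstract realType. *)
From HB Require Import structures.
From mathcomp Require Import all_boot all_order all_algebra.
From mathcomp Require Import all_classical all_reals all_analysis.

Set Implicit Arguments.
Unset Strict Implicit.
Unset Printing Implicit Defensive.

Import Order.TTheory GRing.Theory Num.Theory.
Import numFieldNormedType.Exports.

Local Open Scope classical_set_scope.
Local Open Scope ring_scope.

Definition compactly_supported (R : realType) (f : R -> R) : Prop :=
  compact (closure [set x | f x != 0]).

(** * Brownian motion on [0, +oo[ *)

Definition independent_increments d (T : measurableType d) (R : realType)
    (P : probability T R) (W : R -> T -> R) : Prop :=
  forall (n : nat) (t : nat -> R),
    0 <= t 0%N -> (forall i, (i < n)%N -> t i <= t i.+1) ->
  forall A : nat -> set (measurableTypeR R), (forall i, measurable (A i)) ->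
    let increment i : T -> R := W (t i.+1) \- W (t i) in
    P (\bigcap_(i < n) (increment i @^-1` A i)) =
    (\prod_(i < n) P (increment i @^-1` A i))%E.

(* The times t < 0 are left unconstrained. The second parameter of normal_prob
   is the standard deviation. *)
Record brownian_motion d (T : measurableType d) (R : realType)
    (P : probability T R) (W : R -> T -> R) : Prop := BrownianMotion {
  bm_measurable : forall t, 0 <= t -> measurable_fun setT (W t) ;
  bm_start : {ae P, forall w, W 0 w = 0} ;
  bm_independent : independent_increments P W ;
  bm_gaussian : forall s t, 0 <= s -> s < t ->
    forall A : set (measurableTypeR R), measurable A ->
      P [set w | A (W t w - W s w)] = normal_prob 0 (Num.sqrt (t - s)) A ;
  bm_continuous :
    {ae P, forall w, {within `[0, +oo[, continuous (fun t => W t w)}} }.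

(** * The stochastic Airy operator, for a fixed path W *)

(* Functions on [0, +oo[ are functions R -> R of which only the restriction to
   [0, +oo[ matters; elements of L^2 are such functions up to equality almost
   everywhere on [0, +oo[. *)
Section airy.
Context {R : realType}.
Local Notation mu := (@lebesgue_measure R).
Local Notation half_line := ([set` `[0, +oo[] : set R).

Definition L2 (f : R -> R) : Prop :=
  measurable_fun half_line f /\
  mu.-integrable half_line (fun x => (f x ^+ 2)%:E).

Definition L2_inner (f g : R -> R) : R := \int[mu]_(x in half_line) (f x * g x).

Definition L2_normsq (f : R -> R) : R := L2_inner f f.

Definition sqrtV (f : R -> R) : R -> R := fun x => Num.sqrt x * f x.

Definition star_normsq (f : R -> R) : R :=
  L2_normsq (derive1 f) + L2_normsq (sqrtV f) + L2_normsq f.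

(* C_0^oo([0, +oo[), as the restrictions to [0, +oo[ of the smooth compactly
   supported functions on R. *)
Definition smooth_cs (f : R -> R) : Prop :=
  (forall n x, derivable (derive1n n f) x 1) /\ compactly_supported f.

(* The boundary parameter w ranges over ]-oo, +oo]. *)
Definition form_core (w : \bar R) (f : R -> R) : Prop :=
  smooth_cs f /\ (w = +oo%E -> f 0 = 0).

Definition xi (beta : R) (W : R -> R) (f : R -> R) : R :=
  - (2 / Num.sqrt beta) * \int[mu]_(x in half_line) (derive1 f x * W x).

Definition airy_form (beta : R) (w : \bar R) (W f : R -> R) : R :=
  (if w is r%:E then r * f 0 ^+ 2 else 0) +
  L2_normsq (derive1 f) + L2_normsq (sqrtV f) + xi beta W (fun x => f x ^+ 2).

(* The star-norm closure of the form core, realized inside L^2: f belongs to it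
   when it is the L^2 limit of a star-norm Cauchy sequence of the core. *)
Definition star_approx (w : \bar R) (f : R -> R) (phi : nat -> R -> R) : Prop :=
  [/\ forall n, form_core w (phi n),
      forall e, 0 < e -> exists N, forall m n, (N <= m)%N -> (N <= n)%N ->
        star_normsq (phi m \- phi n) < e &
      L2_normsq (phi n \- f) @[n --> \oo] --> 0].

Definition form_domain (w : \bar R) (f : R -> R) : Prop :=
  L2 f /\ exists phi, star_approx w f phi.

(* Extension of airy_form by continuity to the form domain. *)
Definition form_ext (beta : R) (w : \bar R) (W f : R -> R) : R :=
  get [set e : R | forall phi, star_approx w f phi ->
    airy_form beta w W (phi n) @[n --> \oo] --> e].

(* The associated symmetric bilinear form, by polarization. *)
Definition form_ext2 (beta : R) (w : \bar R) (W f g : R -> R) : R :=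
  (form_ext beta w W (f \+ g) - form_ext beta w W (f \- g)) / 4.

(* Graph of the self-adjoint operator attached to the closed semibounded form
   by the first representation theorem: f is in the domain of H and H f = g. *)
Definition airy_op (beta : R) (w : \bar R) (W f g : R -> R) : Prop :=
  [/\ form_domain w f, L2 g &
      forall psi, form_domain w psi -> form_ext2 beta w W f psi = L2_inner g psi].

(* dim ker (H - lambda) = n, modulo equality almost everywhere. *)
Definition eigenspace_dim (H : (R -> R) -> (R -> R) -> Prop)
    (lambda : R) (n : nat) : Prop :=
  exists e : 'I_n -> R -> R,
  [/\ forall i, H (e i) (lambda \*o e i),
      forall c : 'I_n -> R,
        {ae mu, forall x, half_line x -> \sum_(i < n) c i * e i x = 0} ->
        forall i, c i = 0 &
      forall f, H f (lambda \*o f) -> exists c : 'I_n -> R,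
        {ae mu, forall x, half_line x -> f x = \sum_(i < n) c i * e i x}].

(* Lam 0 <= Lam 1 <= ... lists the eigenvalues of H with multiplicity; they do
   not accumulate. *)
Record eigenvalue_sequence (H : (R -> R) -> (R -> R) -> Prop)
    (Lam : nat -> R) : Prop := EigenvalueSequence {
  eigenvalues_nondecreasing : {homo Lam : m n / (m <= n)%N >-> m <= n} ;
  eigenvalues_multiplicity : forall lambda, exists2 n,
    eigenspace_dim H lambda n & ([set k | Lam k = lambda] #= `I_n)%card ;
  eigenvalues_no_accumulation : Lam k @[k --> \oo] --> +oo }.

End airy.

(** * Locally finite integer-valued measures *)

(* A measure on a Borel set A is encoded as its extension by zero: a Borel
   measure on R that vanishes on the complement of A. *)
Record Nsharp_spec (R : realType) (A : set R)
    (m : {measure set (measurableTypeR R) -> \bar R}) : Prop := NsharpSpec {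
  Nsharp_concentrated : m (~` A) = 0%E ;
  Nsharp_integer : forall S, measurable S ->
    m S = +oo%E \/ exists n : nat, m S = n%:R%:E ;
  Nsharp_finite : forall K : set R, measurable (K : set (measurableTypeR R)) ->
    bounded_set K -> (m K < +oo)%E }.

Record Nsharp (R : realType) (A : set R) := MkNsharp {
  Nsharp_measure :> {measure set (measurableTypeR R) -> \bar R} ;
  NsharpP : Nsharp_spec A Nsharp_measure }.

Section Nsharp_topology.
Context {R : realType} (A : set R).

Lemma mzero_Nsharp : Nsharp_spec A (mzero : {measure set _ -> \bar R}).
Proof.
by split=> [//|S _|K _ _]; [right; exists 0%N | rewrite /= /mzero ltry].
Qed.

HB.instance Definition _ := gen_eqMixin (Nsharp A).
HB.instance Definition _ := gen_choiceMixin (Nsharp A).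
HB.instance Definition _ := isPointed.Build (Nsharp A) (MkNsharp mzero_Nsharp).

Definition Nsharp_eval (f : R -> R) (m : Nsharp A) : R :=
  \int[Nsharp_measure m]_(x in A) f x.

(* Subbase: the preimages of open sets under m |-> \int[m]_(x in A) f x, for f
   continuous and compactly supported. *)
HB.instance Definition _ := isSubBaseTopological.Build (Nsharp A)
  [set fU : (R -> R) * set R |
    [/\ continuous fU.1, compactly_supported fU.1 & open fU.2]]
  (fun fU => Nsharp_eval fU.1 @^-1` fU.2).

Definition Nsharp_borel := g_sigma_algebraType (@open (Nsharp A)).

End Nsharp_topology.

Section Nsharp_construct.
Context {R : realType}.

Lemma Nsharp_restr_spec (A : set R) (mA : measurable (A : set (measurableTypeR R)))
  (m : Nsharp [set: R]) : Nsharp_spec A (mrestr m mA : {measure set _ -> \bar R}).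
Proof.
have [_ mi mf] := NsharpP m; split => /=.
- by rewrite /mrestr setICl measure0.
- by move=> S mS; apply: mi; exact: measurableI.
- move=> K mK bK; apply: le_lt_trans (mf K mK bK).
  by apply: le_measure; rewrite ?inE//; exact: measurableI.
Qed.

Definition Nsharp_restr (A : set R) (mA : measurable (A : set (measurableTypeR R)))
  (m : Nsharp [set: R]) : Nsharp A := MkNsharp (Nsharp_restr_spec mA m).

(* The point process \sum_k \d_(Lam k); it is given the junk value 0 when it is
   not locally finite. *)
Definition point_process (Lam : nat -> R) : Nsharp [set: R] :=
  let m : {measure set (measurableTypeR R) -> \bar R} :=
    mseries (fun k => \d_(Lam k : measurableTypeR R)) 0 in
  if pselect (Nsharp_spec [set: R] m) is left p then MkNsharp p else point.

End Nsharp_construct.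

(** * Traces, and covariances of [0, +oo]-valued random variables *)

Definition trace_exp (R : realType) (Lam : nat -> R) (t : R) : \bar R :=
  (\sum_(0 <= k <oo) (expR (- t * Lam k))%:E)%E.

(* Same formulas as the library's covariance and variance, which are restricted
   to real-valued random variables. *)
Definition ecovariance d (T : measurableType d) (R : realType)
    (P : probability T R) (X Y : T -> \bar R) : \bar R :=
  (\int[P]_w ((X w - \int[P]_v X v) * (Y w - \int[P]_v Y v)))%E.

Definition evariance d (T : measurableType d) (R : realType)
    (P : probability T R) (X : T -> \bar R) : \bar R := ecovariance P X X.

(* Main.v *)
Require Import Defs.
From mathcomp Require Import all_boot all_order all_algebra finmap.
From mathcomp Require Import all_classical all_reals all_analysis.
From mathcomp Require Import measurable_realfun ring lra.

Set Implicit Arguments.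
Unset Strict Implicit.
Unset Printing Implicit Defensive.

Import Order.TTheory GRing.Theory Num.Theory.
Import numFieldNormedType.Exports.

Local Open Scope classical_set_scope.
Local Open Scope ring_scope.

(* Choose times t_i -> 0 one after the other, each so small that the trace at
   t_i is almost uncorrelated with the traces at the earlier times. The variances
   being bounded, the centred traces then have averages that tend to 0 almost
   surely along a subsequence. Split the trace at t_i into the contributions of
   the eigenvalues in B and in B^c: as B is bounded above, the first one is a
   finite sum that tends to the number of eigenvalues in B, so this number is the
   limit of the averages of E Tr(t_i) - \int_(B^c) e^(- t_i x), a function of the
   restriction of the point process to B^c. *)

(** * Measurability of integrals as functions of a locally finite measure *)

Section Nsharp_measurability.
Context {R : realType} (A : set R).

Lemma Nsharp_eval_continuous (f : R -> R) :
  continuous f -> compactly_supported f ->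
  continuous (Nsharp_eval f : Nsharp A -> R).
Proof.
move=> cf sf; apply/continuousP => U oU.
pose fU : (R -> R) * set R := (f, U).
(* Open sets are unions of finite intersections of subbasic sets; here one intersection, over the
   single index [fU], is enough. *)
exists [set Nsharp_eval f @^-1` U]; last by rewrite bigcup_set1.
move=> _ ->; exists [fset fU]%fset; first by move=> i /fset1P ->; rewrite inE.
rewrite eqEsubset; split => m /=; first by move=> /(_ fU); apply; exact: fset11.
by move=> Um i /fset1P ->.
Qed.

Lemma measurable_Nsharp_eval (f : R -> R) :
  continuous f -> compactly_supported f ->
  measurable_fun setT (Nsharp_eval f : Nsharp_borel A -> R).
Proof.
move=> cf sf; apply: (measurability _ (RGenOpens.measurableE R)) => _ [_ [a [b ->] <-]].
rewrite setTI; apply: sub_sigma_algebra.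
by have /continuousP := Nsharp_eval_continuous cf sf; apply; exact: interval_open.
Qed.

End Nsharp_measurability.

Section Nsharp_integral.
Context {R : realType} (A : set R).

(** A trapezoid: 1 where [|x| <= n - 1], 0 where [|x| >= n], affine in between. For [f >= 0] the
    products [f \* cutoff n] are test functions for the topology of [Nsharp A] that increase to
    [f]. *)
Definition cutoff (n : nat) (x : R) : R := Num.min 1 (Num.max 0 (n%:R - `|x|)).

Lemma cutoff_ge0 n x : 0 <= cutoff n x.
Proof. by rewrite le_min ler01 le_max lexx. Qed.

Lemma cutoff_le1 n x : cutoff n x <= 1.
Proof. by rewrite ge_min lexx. Qed.

Lemma cutoff_eq0 n x : n%:R <= `|x| -> cutoff n x = 0.
Proof. by rewrite -subr_le0 /cutoff => /max_l ->; rewrite min_r. Qed.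

Lemma cutoff_eq1 n x : `|x| + 1 <= n%:R -> cutoff n x = 1.
Proof.
rewrite -lerBrDl /cutoff => nx; rewrite max_r ?min_l//.
exact: le_trans nx.
Qed.

Lemma cutoff_homo x : {homo cutoff ^~ x : m n / (m <= n)%N >-> m <= n}.
Proof.
move=> m n mn; rewrite /cutoff le_min ge_min lexx/= ge_min; apply/orP; right.
by rewrite ge_max !le_max lexx/= lerD2r ler_nat mn orbT.
Qed.

Lemma continuous_cutoff n : continuous (cutoff n).
Proof.
move=> x; rewrite (_ : cutoff n =
  (cst 1 : R -> R^o) \min ((cst 0 : R -> R^o) \max (fun y => n%:R - `|y|)))//.
apply: continuous_min; first exact: cvg_cst.
apply: continuous_max; first exact: cvg_cst.
by apply: cvgB; [exact: cvg_cst | exact: norm_continuous].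
Qed.

Lemma compactly_supported_cutoff (f : R -> R) n :
  compactly_supported (f \* cutoff n).
Proof.
apply: (@subclosed_compact R^o _ [set` `[- n%:R, n%:R]%R]).
- exact: closed_closure.
- exact: segment_compact.
- rewrite closureE => x; apply; split; first exact: interval_closed.
  move=> y /=; apply: contraNP; rewrite in_itv/= -ler_norml => /negP.
  by rewrite -ltNge => /ltW /cutoff_eq0 ->; rewrite mulr0.
Qed.

(** The integrand is at most the maximum of [f] on [[-n, n]] times the indicator of that segment,
    whose mass is finite by local finiteness. *)
Lemma integral_cutoff_lty (mA : measurable (A : set (measurableTypeR R)))
    (m : Nsharp A) (f : R -> R) n :
  continuous f -> (forall x, 0 <= f x) ->
  (\int[Nsharp_measure m]_(x in A) ((f \* cutoff n) x)%:E < +oo)%E.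
Proof.
move=> cf f0; have [_ _ mfin] := NsharpP m.
pose K : set (measurableTypeR R) := [set` `[- n%:R, n%:R]].
have mK : measurable K by exact: measurable_itv.
have [c _ fc] : exists2 c : R, c \in `[- n%:R, n%:R]%R &
    forall t, t \in `[- n%:R, n%:R]%R -> f t <= f c.
  apply: EVT_max; first by rewrite ge0_cp.
  exact: continuous_subspaceT.
have mf : measurable_fun A (fun x => ((f \* cutoff n) x)%:E : \bar R).
  apply/measurable_EFinP; apply: measurable_funTS.
  apply: continuous_measurable_fun => x.
  by apply: cvgM; [exact: cf | exact: continuous_cutoff].
have m1 : measurable_fun A (fun x => (\1_K x)%:E : \bar R).
  by apply/measurable_EFinP/measurable_funTS; exact: measurable_indic.
have : (\int[Nsharp_measure m]_(x in A) ((f \* cutoff n) x)%:E <=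
        \int[Nsharp_measure m]_(x in A) ((f c)%:E * (\1_K x)%:E))%E.
  apply: ge0_le_integral => //.
  - by move=> x _; rewrite lee_fin mulr_ge0// cutoff_ge0.
  - exact: measurable_funeM.
  - move=> x _; rewrite -EFinM lee_fin indicE /=.
    have [xK|xK] := boolP (x \in K).
      rewrite mulr1 -[leRHS]mulr1 ler_pM ?cutoff_ge0 ?cutoff_le1//.
      by apply: fc; move: xK; rewrite inE.
    rewrite mulr0 cutoff_eq0 ?mulr0//.
    move: xK; rewrite notin_setE /K/= in_itv/= -ler_norml => /negP.
    by rewrite -ltNge => /ltW.
move=> /le_lt_trans; apply; rewrite ge0_integralZl ?lee_fin//.
rewrite integral_indic//; apply: lte_mul_pinfty; rewrite ?lee_fin//.
apply: le_lt_trans (mfin K mK _).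
  by apply: le_measure; rewrite ?inE//; exact: measurableI.
exact/compact_bounded/segment_compact.
Qed.

(** The exponentials integrated later have no compact support, so they are reached by monotone
    convergence along the cutoffs; the limit may be infinite. *)
Lemma measurable_Nsharp_integral (mA : measurable (A : set (measurableTypeR R)))
    (f : R -> R) :
  continuous f -> (forall x, 0 <= f x) ->
  measurable_fun setT
    (fun m : Nsharp_borel A => \int[Nsharp_measure m]_(x in A) (f x)%:E)%E.
Proof.
move=> cf f0.
have cfn n : continuous (f \* cutoff n).
  by move=> x; apply: cvgM; [exact: cf | exact: continuous_cutoff].
apply: (@emeasurable_fun_cvg _ (Nsharp_borel A) R setT
  (fun n (m : Nsharp A) => (Nsharp_eval (f \* cutoff n) m)%:E)).
  move=> n; apply/measurable_EFinP.
  exact: (measurable_Nsharp_eval (cfn n) (@compactly_supported_cutoff f n)).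
move=> m _.
(* [Nsharp_eval] is real-valued and would be 0 on an infinite integral; finiteness of the truncated
   integrals excludes this. *)
have -> : (fun n => (Nsharp_eval (f \* cutoff n) m)%:E) =
    (fun n => \int[Nsharp_measure m]_(x in A) ((f \* cutoff n) x)%:E)%E.
  apply/funext => n; rewrite /Nsharp_eval /Rintegral fineK//.
  rewrite ge0_fin_numE; first exact: integral_cutoff_lty.
  by apply: integral_ge0 => x _; rewrite lee_fin mulr_ge0// cutoff_ge0.
have -> : (\int[Nsharp_measure m]_(x in A) (f x)%:E =
    \int[Nsharp_measure m]_(x in A) limn (fun n => ((f \* cutoff n) x)%:E))%E.
  apply: eq_integral => x _; apply/esym/cvg_lim => //.
  apply: cvg_near_cst; near=> n; rewrite /= cutoff_eq1 ?mulr1//.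
  by near: n; exact: nbhs_infty_ger.
apply: cvg_monotone_convergence => //.
- move=> n; apply/measurable_EFinP; apply: measurable_funTS.
  by apply: continuous_measurable_fun; exact: cfn.
- by move=> n x _; rewrite lee_fin mulr_ge0// cutoff_ge0.
- by move=> x _ p q pq; rewrite lee_fin ler_wpM2l// cutoff_homo.
Unshelve. all: by end_near.
Qed.

End Nsharp_integral.

(** * Point process of a sequence tending to infinity *)

Lemma nneseries_trunc {R : realType} (u : (\bar R)^nat) (N : nat) :
  (forall k, (0 <= u k)%E) -> (forall k, (N <= k)%N -> u k = 0%E) ->
  (\sum_(0 <= k <oo) u k = \sum_(0 <= k < N) u k)%E.
Proof.
move=> u0 uN; rewrite (nneseries_split 0 N)// add0n.
by rewrite [X in (_ + X)%E]eseries0 ?adde0// => k Nk _; exact: uN.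
Qed.

Section point_process.
Context {R : realType} (Lam : nat -> R).

Let dirac_series : {measure set (measurableTypeR R) -> \bar R} :=
  mseries (fun k => \d_(Lam k : measurableTypeR R)) 0.

(** If the series of zeros and ones is finite, its tails tend to 0. A tail below 1 contains no term
    equal to 1, so the series is a finite sum. *)
Let dirac_series_integer (S : set (measurableTypeR R)) :
  dirac_series S = +oo%E \/ exists n : nat, dirac_series S = n%:R%:E.
Proof.
have d0 k : (0 <= \d_(Lam k : measurableTypeR R) S :> \bar R)%E by [].
have [->|] := eqVneq (dirac_series S) +oo%E; first by left.
rewrite -ltey => fin; right.
have tail0 := nneseries_tail_cvg fin (fun k _ => d0 k).
have [N _ tailN] := tail0 _
  (@nbhs_open_ereal_lt _ 0 (fun=> 1) ltr01).
exists (\sum_(0 <= k < N) (Lam k \in S))%N.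
rewrite /dirac_series/= /mseries (nneseries_trunc (N := N))//.
  by rewrite natr_sum -sumEFin; apply: eq_bigr => k _; rewrite /= diracE.
move=> k Nk; rewrite /= diracE; case: (boolP (Lam k \in S)) => // kS.
have /= := tailN k Nk; rewrite ltNge => /negP[].
apply: le_trans (@nneseries_lim_ge _ _ xpredT k k.+1 _) => //.
by rewrite big_nat1 diracE kS.
Qed.

Hypothesis Lam_cvg : Lam k @[k --> \oo] --> +oo.

Lemma eventually_notin_has_ubound (S : set R) : has_ubound S ->
  exists N, forall k, (N <= k)%N -> Lam k \notin S.
Proof.
move=> [c Sc]; have /cvgryPgt/(_ c)[N _ cN] := Lam_cvg.
exists N => k /cN/= ck; apply/negP; rewrite inE => /Sc.
by rewrite leNgt ck.
Qed.

Let dirac_series_lty (S : set (measurableTypeR R)) : has_ubound (S : set R) ->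
  (dirac_series S < +oo)%E.
Proof.
move=> /eventually_notin_has_ubound[N SN]; rewrite /dirac_series/= /mseries.
rewrite (nneseries_trunc (N := N))//.
  by apply: lte_sum_pinfty => k _; rewrite /= diracE ltry.
by move=> k /SN /negbTE kS; rewrite /= diracE kS.
Qed.

(** Divergence of [Lam] to [+oo] gives local finiteness, so the junk value of [point_process] is not
    taken. *)
Lemma point_processE : Nsharp_measure (point_process Lam) = dirac_series.
Proof.
rewrite /point_process; case: pselect => //= -[]; split.
- by rewrite setCT measure0.
- by move=> S _; exact: dirac_series_integer.
- move=> K mK bK; apply: dirac_series_lty.
  (* [bounded_set] bounds the norm by every number strictly above [M], hence the witness [M + 1]. *)
  have [M [_ KM]] := bK; exists (M + 1) => x Kx.
  by rewrite (le_trans (ler_norm x))//; apply: KM Kx; rewrite ltrDl.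
Qed.

Lemma point_process_bounded_above (S : set R) (N : nat) :
  (forall k, (N <= k)%N -> Lam k \notin S) ->
  point_process Lam S = (\sum_(0 <= k < N) \1_S (Lam k))%:E.
Proof.
move=> SN; rewrite point_processE /dirac_series/= /mseries.
rewrite (nneseries_trunc (N := N))//.
  by rewrite -sumEFin; apply: eq_bigr => k _; rewrite /= diracE indicE.
by move=> k /SN /negbTE kS; rewrite /= diracE kS.
Qed.

Lemma integral_restr_point_process (A : set R)
    (mA : measurable (A : set (measurableTypeR R))) (f : R -> R) :
  (forall x, 0 <= f x) -> measurable_fun setT f ->
  (\int[Nsharp_measure (Nsharp_restr mA (point_process Lam))]_(x in A) (f x)%:E =
   \sum_(0 <= k <oo) (\1_A (Lam k) * f (Lam k))%:E)%E.
Proof.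
move=> f0 mf; have mfA : measurable_fun A (fun x => (f x)%:E : \bar R).
  by apply/measurable_EFinP; exact: measurable_funTS.
rewrite (@eq_measure_integral _ _ _ _ dirac_series)/=; last first.
  by move=> S mS SA; rewrite /mrestr setIidl// point_processE.
rewrite ge0_integral_measure_series//; last by move=> x _; rewrite lee_fin.
by apply: eq_eseriesr => k _; rewrite integral_dirac//= diracE indicE EFinM.
Qed.

End point_process.

(** * Almost sure convergence of averages of weakly correlated variables *)

Section weakly_correlated_mean.
Context d (T : measurableType d) (R : realType) (P : probability T R).
Context (y : nat -> T -> R) (M : R).
Hypothesis my : forall i, measurable_fun setT (y i).
Hypothesis y_var : forall i, (\int[P]_w (y i w * y i w)%:E <= M%:E)%E.
Hypothesis y_cov : forall i j, (j < i)%N ->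
  (\int[P]_w (y i w * y j w)%:E <= (i.+1%:R^-1)%:E)%E.

Let integrable_sqr i : P.-integrable setT (fun w => (y i w * y i w)%:E).
Proof.
apply/integrableP; split.
  by apply/measurable_EFinP; exact: measurable_funM.
under eq_integral do rewrite gee0_abs ?lee_fin -?expr2 ?sqr_ge0//.
exact: le_lt_trans (y_var i) (ltry _).
Qed.

(** Domination by the sum of the two squares, from [(|a| - |b|)^2 >= 0]. *)
Let integrable_mul i j : P.-integrable setT (fun w => (y i w * y j w)%:E).
Proof.
apply: (@le_integrable _ _ _ _ _ _ _
  ((fun w => (y i w * y i w)%:E) \+ (fun w => (y j w * y j w)%:E))%E) => //.
- by apply/measurable_EFinP; exact: measurable_funM.
- move=> w _; rewrite /= lee_fin normrM.
  rewrite [leRHS]ger0_norm ?addr_ge0 -?expr2 ?sqr_ge0//.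
  rewrite -(real_normK (num_real (y i w))) -(real_normK (num_real (y j w))).
  have := sqr_ge0 (`|y i w| - `|y j w|); rewrite sqrrB.
  have : 0 <= `|y i w| * `|y j w| by exact: mulr_ge0.
  by lra.
- exact: integrableD.
Qed.

Let integrable_cross n :
  P.-integrable setT (fun w => (\sum_(0 <= j < n) y n w * y j w)%:E).
Proof.
under eq_fun do rewrite -sumEFin.
by apply: integrable_sum => // j _; exact: integrable_mul.
Qed.

(** There are [n] terms, each at most [1 / (n + 1)]: the decay rate in [y_cov] is chosen for
    this. *)
Let integral_cross n :
  (\int[P]_w (\sum_(0 <= j < n) y n w * y j w)%:E <= 1)%E.
Proof.
under eq_integral do rewrite -sumEFin.
rewrite integral_sum//.
apply: (@le_trans _ _ (\sum_(0 <= j < n) (n.+1%:R^-1)%:E)%E).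
  rewrite !big_mkord; apply: lee_sum => j _; exact: y_cov.
rewrite sumEFin lee_fin sumr_const_nat subn0 -[_ *+ n]mulr_natl.
by rewrite ler_pdivrMr ?ltr0n// mul1r ler_nat.
Qed.

(** Adding [y n] to the partial sum adds twice the cross term and one square to its second moment,
    hence at most [1 + 1 + M]: the growth is linear in [n]. *)
Lemma integral_sqr_series n :
  P.-integrable setT (fun w => (series (y ^~ w) n ^+ 2)%:E) /\
  (\int[P]_w (series (y ^~ w) n ^+ 2)%:E <= (n%:R * (M + 2))%:E)%E.
Proof.
elim: n => [|n [IHi IH]].
  have -> : (fun w => (series (y ^~ w) 0 ^+ 2)%:E) = cst 0%E :> (T -> \bar R).
    by apply/funext => w; rewrite /series/= big_geq// expr0n.
  by rewrite integral0 mul0r; split => //; exact: integrable0.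
pose c w := (\sum_(0 <= j < n) y n w * y j w)%:E.
pose q w := (y n w * y n w)%:E.
have -> : (fun w => (series (y ^~ w) n.+1 ^+ 2)%:E) =
    ((fun w => (series (y ^~ w) n ^+ 2)%:E) \+ ((c \+ c) \+ q))%E.
  apply/funext => w; rewrite /c /q /= -!EFinD; congr EFin.
  by rewrite /series/= big_nat_recr//= -mulr_sumr; ring.
have ic : P.-integrable setT c := integrable_cross n.
have iq : P.-integrable setT q := integrable_sqr n.
have icc := integrableD measurableT ic ic.
have iccq := integrableD measurableT icc iq.
split; first exact: integrableD.
rewrite integralD// integralD// integralD//.
have -> : n.+1%:R * (M + 2) = n%:R * (M + 2) + (1 + 1 + M).
  by rewrite -natr1; ring.
rewrite !EFinD; apply: leeD; first exact: IH.
by apply: leeD; [apply: leeD; exact: integral_cross | exact: y_var].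
Qed.

(** The second moments of the averages are of order [1 / n], which is summable along powers of 2.
    The sum of the squared averages then has finite expectation, so it is almost surely finite and
    its terms tend to 0. *)
Lemma arithmetic_mean_cvg0_ae :
  {ae P, forall w, arithmetic_mean (y ^~ w) (2 ^ k.+1)%N @[k --> \oo] --> 0}.
Proof.
pose z (k : nat) w := (arithmetic_mean (y ^~ w) (2 ^ k.+1)%N ^+ 2)%:E.
have z0 k w : (0 <= z k w)%E by rewrite lee_fin sqr_ge0.
have mz k : measurable_fun setT (z k).
  apply/measurable_EFinP; apply: measurable_funX; apply: measurable_funM => //.
  by apply: measurable_sum => i; exact: my.
have M0 : 0 <= M.
  rewrite -lee_fin; apply: le_trans (y_var 0%N).
  by apply: integral_ge0 => w _; rewrite lee_fin -expr2 sqr_ge0.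
have zle k : (\int[P]_w z k w <= ((M + 2) / (2 ^ k.+1)%:R)%:E)%E.
  (* [arithmetic_mean] at [n] averages [n.+1] terms; the resulting bound [(M + 2) / n.+1] is then
     relaxed to [(M + 2) / n]. *)
  set n := (2 ^ k.+1)%N; have [intS leS] := integral_sqr_series n.+1.
  have -> : z k = (fun w => (n.+1%:R^-1 ^+ 2)%:E *
      (series (y ^~ w) n.+1 ^+ 2)%:E)%E.
    by apply/funext => w; rewrite /z /arithmetic_mean/= exprMn EFinM.
  rewrite integralZl//.
  apply: le_trans (lee_wpmul2l _ leS) _; first by rewrite lee_fin sqr_ge0.
  rewrite -EFinM lee_fin.
  have -> : n.+1%:R^-1 ^+ 2 * (n.+1%:R * (M + 2)) = (M + 2) / n.+1%:R.
    have : n.+1%:R != 0 :> R by rewrite pnatr_eq0.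
    by move: n.+1%:R => c c0; field.
  rewrite ler_wpM2l ?addr_ge0// lef_pV2 ?posrE ?ltr0n ?expn_gt0//.
  by rewrite ler_nat.
have intz : (\int[P]_w (\sum_(0 <= k <oo) z k w) < +oo)%E.
  rewrite integral_nneseries//.
  apply: (@le_lt_trans _ _ (M + 2)%:E); last exact: ltry.
  (* Geometric series: with exponent [k.+1], starting from [k = 0], the bounds add up to exactly
     [M + 2]. *)
  apply: le_trans (epsilon_trick0 xpredT _); last by rewrite addr_ge0.
  apply: lee_nneseries => [k _ _|k _]; [exact: integral_ge0 | exact: zle].
have : {ae P, forall w, setT w -> (\sum_(0 <= k <oo) z k w)%E \is a fin_num}.
  apply: integrable_ae => //; apply/integrableP; split.
    by apply: ge0_emeasurable_sum => // k _; exact: mz.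
  under eq_integral do rewrite gee0_abs ?nneseries_ge0//.
  exact: intz.
apply: filterS => w /(_ I) fz.
apply/cvgr0Pnorm_lt => e e0.
have fz_lty : (\sum_(0 <= k <oo) z k w < +oo)%E by rewrite ltey_eq fz.
have tail0 := nneseries_tail_cvg fz_lty (fun k _ => z0 k w).
have e20 : 0 < e ^+ 2 by rewrite exprn_gt0.
have [N _ tailN] := tail0 _ (@nbhs_open_ereal_lt _ 0 (fun=> e ^+ 2) e20).
exists N => // k Nk.
have : (z k w < (e ^+ 2)%:E)%E.
  apply: le_lt_trans (tailN k Nk).
  apply: le_trans (@nneseries_lim_ge _ _ xpredT k k.+1 _) => //.
  by rewrite big_nat1.
by rewrite lte_fin -real_normK ?num_real// ltr_pXn2r ?nnegrE// ltW.
Qed.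

End weakly_correlated_mean.

(** * Reduction of extended covariances to real-valued variables *)

Section ecovariance_facts.
Context d (T : measurableType d) (R : realType) (P : probability T R).

(* If the mean is +oo, the centred variable is constantly -oo, since
   +oo - +oo = -oo in \bar R, and the variance is +oo. *)
Lemma evariance_lty_integrable (X : T -> \bar R) :
  measurable_fun setT X -> (forall w, (0 <= X w)%E) ->
  (evariance P X < +oo)%E -> P.-integrable setT X.
Proof.
move=> mX X0 varX; apply/integrableP; split => //.
under eq_integral do rewrite gee0_abs//.
rewrite ltey; apply/eqP => EX; move: varX.
rewrite /evariance /ecovariance EX.
under eq_integral do rewrite addeNy mulNyNy.
rewrite integral_cst// [X in (+oo * X)%E](_ : _ = 1%E) ?mule1 ?ltxx//.
exact: probability_setT.
Qed.

Lemma ecovariance_fine (X Y : T -> \bar R) :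
  P.-integrable setT X -> P.-integrable setT Y ->
  ecovariance P X Y = (\int[P]_w ((fine (X w) - fine (\int[P]_v X v)) *
                                  (fine (Y w) - fine (\int[P]_v Y v)))%:E)%E.
Proof.
move=> iX iY; have /integrableP[mX _] := iX; have /integrableP[mY _] := iY.
have mfine (Z : T -> \bar R) : measurable_fun setT Z ->
    measurable_fun setT (fun w => fine (Z w) - fine (\int[P]_v Z v)%E).
  by move=> mZ; apply: measurable_funB => //; exact: measurableT_comp.
apply: ae_eq_integral => //.
- by apply: emeasurable_funM; exact: emeasurable_funB.
- by apply/measurable_EFinP; apply: measurable_funM; exact: mfine.
- have := integrable_ae measurableT iX; have := integrable_ae measurableT iY.
  apply: filterS2 => w /(_ I) fY /(_ I) fX _.
  by rewrite EFinM !EFinB !fineK// integrable_fin_num.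
Qed.

End ecovariance_facts.

(** * Successive choice of the times *)

Lemma exists_history_sequence (X : Type) (Q : seq X -> X -> Prop) :
  (forall s, exists x, Q s x) ->
  exists t : nat -> X, forall n, Q (mkseq t n) (t n).
Proof.
move=> /choice[f fQ].
(* [state n] lists the first [n] choices, so that each new one may depend on the whole history. *)
pose state := fix state n :=
  if n is m.+1 then rcons (state m) (f (state m)) else [::].
exists (f \o state) => n.
suff -> : mkseq (f \o state) n = state n by exact: fQ.
by elim: n => // n IH; rewrite mkseqS IH.
Qed.

Lemma near_in_seq (I : eqType) (X : Type) (F : set_system X) (FF : Filter F)
    (s : seq I) (Q : I -> X -> Prop) :
  (forall i, i \in s -> \forall x \near F, Q i x) ->
  \forall x \near F, forall i, i \in s -> Q i x.
Proof.
elim: s => [_|i s IH iQ]; first by apply: nearW.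
have Qi := iQ i (mem_head i s).
have Qs : \forall x \near F, forall j, j \in s -> Q j x.
  by apply: IH => j js; apply: iQ; rewrite inE js orbT.
apply: filterS2 Qi Qs => x Qix Qsx j; rewrite inE => /predU1P[->//|].
exact: Qsx.
Qed.

Lemma exists_weakly_correlated_sequence d (T : measurableType d) (R : realType)
    (P : probability T R) (S : R -> T -> \bar R) :
  (forall t, measurable_fun setT (S t)) -> (forall t w, (0 <= S t w)%E) ->
  (limf_esup (fun t => evariance P (S t)) 0^'+ < +oo)%E ->
  (forall u, 0 < u -> ecovariance P (S t) (S u) @[t --> 0^'+] --> 0%E) ->
  exists (t : nat -> R) (M : R),
    [/\ forall n, P.-integrable setT (S (t n)), t n @[n --> \oo] --> 0,
        forall n, (evariance P (S (t n)) <= M%:E)%E &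
        forall m n, (m < n)%N ->
          (ecovariance P (S (t n)) (S (t m)) <= (n.+1%:R^-1)%:E)%E].
Proof.
move=> mS S0 hVar hCov.
have [M [V V0 VM]] : exists M : R, exists2 V, (0:R)^'+ V &
    forall t, V t -> (evariance P (S t) <= M%:E)%E.
  have /ereal_inf_lt[_ [V V0 <-] supV] := hVar.
  (* The maximum with 0 excludes [-oo], so that [fine] keeps the bound. *)
  exists (fine (maxe 0%E (ereal_sup [set evariance P (S t) | t in V]))).
  exists V => // t Vt; rewrite fineK; last first.
    by rewrite ge0_fin_numE ?le_max ?lexx// gt_max ltry.
  by rewrite le_max; apply/orP; right; apply: ereal_sup_ubound; exists t.
(* The length of the history is the index of the new time, so it supplies both the rate at which the
   times vanish and the bound on the covariances. The history [s] is arbitrary here, hence the guard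
   [0 < u], which the chosen times satisfy. *)
have step (s : seq R) : exists t, [/\ 0 < t, V t, t < (size s).+1%:R^-1 &
    forall u, u \in s -> 0 < u ->
      (ecovariance P (S t) (S u) <= ((size s).+1%:R^-1)%:E)%E].
  have e0 : 0 < (size s).+1%:R^-1 :> R by rewrite invr_gt0.
  apply: (@filter_ex _ (0:R)^'+); near=> t; split.
  - by near: t; exact: nbhs_right_gt.
  - by near: t.
  - by near: t; exact: nbhs_right_lt.
  - near: t; apply: near_in_seq => u _.
    have [u0|_] := boolP (0 < u); last exact: nearW.
    have cov_lt : \forall t \near (0:R)^'+,
        (ecovariance P (S t) (S u) < ((size s).+1%:R^-1)%:E)%E.
      exact: (hCov u u0 _
        (@nbhs_open_ereal_lt _ 0 (fun=> (size s).+1%:R^-1) e0)).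
    by apply: filterS cov_lt => t /ltW.
have [t tP] := exists_history_sequence step.
exists t, M; split.
- move=> n; apply: evariance_lty_integrable => //.
  by have [_ Vt _ _] := tP n; exact: le_lt_trans (VM _ Vt) (ltry _).
- apply: (squeeze_cvgr _ (@cvg_cst _ _ _ _ _) (@cvg_harmonic R)).
  apply: nearW => n; have [t0 _ tn _] := tP n.
  by rewrite ltW//= ltW// -[n in n.+1](size_mkseq t).
- by move=> n; have [_ Vt _ _] := tP n; exact: VM.
- move=> m n mn; have [tm0 _ _ _] := tP m; have [_ _ _] := tP n.
  rewrite size_mkseq; apply => //.
  by apply/mapP; exists m => //; rewrite mem_iota.
Unshelve. all: by end_near.
Qed.

(** * Traces and their splitting along [B] *)

Lemma trace_exp_ge0 (R : realType) (Lam : nat -> R) (t : R) :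
  (0 <= trace_exp Lam t)%E.
Proof. by apply: nneseries_ge0 => k _ _; rewrite lee_fin expR_ge0. Qed.

Lemma measurable_trace_exp d (T : measurableType d) (R : realType)
    (Lam : nat -> T -> R) (t : R) :
  (forall k, measurable_fun setT (Lam k)) ->
  measurable_fun setT (fun om => trace_exp (Lam ^~ om) t).
Proof.
move=> mLam; apply: ge0_emeasurable_sum => [k om _ _|k _].
  by rewrite lee_fin expR_ge0.
apply/measurable_EFinP; apply: measurableT_comp => //.
exact: measurable_funM.
Qed.

Lemma trace_exp_split (R : realType) (Lam : nat -> R) (B : set R) (N : nat)
    (t : R) :
  (forall k, (N <= k)%N -> Lam k \notin B) ->
  trace_exp Lam t =
  (\sum_(0 <= k <oo) (\1_(~` B) (Lam k) * expR (- t * Lam k))%:E +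
   (\sum_(0 <= k < N) \1_B (Lam k) * expR (- t * Lam k))%:E)%E.
Proof.
move=> BN; rewrite -sumEFin.
rewrite -(@nneseries_trunc _ (fun k => (\1_B (Lam k) * expR (- t * Lam k))%:E)).
- rewrite -nneseriesD => [|k _ _|k _ _]; rewrite ?lee_fin ?mulr_ge0 ?expR_ge0//.
  apply: eq_eseriesr => k _.
  rewrite -EFinD -mulrDl !indicE in_setC.
  by case: (_ \in _); rewrite ?add0r ?addr0 mul1r.
- by move=> k; rewrite lee_fin mulr_ge0// expR_ge0.
- by move=> k /BN /negbTE kB; rewrite indicE kB mul0r.
Qed.

Lemma arithmetic_meanB (R : realType) (u v : R^nat) n :
  arithmetic_mean (u \- v) n = arithmetic_mean u n - arithmetic_mean v n.
Proof. by rewrite /arithmetic_mean/= /series/= sumrB mulrBr. Qed.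

(** * Recovery of the number of points in [B] *)

Theorem lemma3p2 (R : realType) (d : measure_display) (T : measurableType d)
    (P : probability T R) (W : R -> T -> R) (beta : R) (w : \bar R)
    (Lam : nat -> T -> R)
    (hW : brownian_motion P W)
    (hbeta : 0 < beta) (hw : (-oo < w)%E)
    (mLam : forall k, measurable_fun setT (Lam k))
    (hLam : {ae P, forall om,
      eigenvalue_sequence (airy_op beta w (W ^~ om)) (Lam ^~ om)})
    (hVar : (limf_esup (fun t : R => evariance P (fun om => trace_exp (Lam ^~ om) t))
               0^'+ < +oo)%E)
    (hCov : forall u : R, 0 < u ->
      ecovariance P (fun om => trace_exp (Lam ^~ om) t)
                    (fun om => trace_exp (Lam ^~ om) u) @[t --> 0^'+] --> 0%E)
    (B : set R) (mB : measurable (B : set (measurableTypeR R)))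
    (hB : has_ubound B) :
  exists2 F : Nsharp_borel (~` B) -> R,
    measurable_fun setT F &
    {ae P, forall om, point_process (Lam ^~ om) B =
      (F (Nsharp_restr (measurableC mB) (point_process (Lam ^~ om))))%:E}.
Proof.
pose S t om := trace_exp (Lam ^~ om) t.
have mS t : measurable_fun setT (S t) by exact: measurable_trace_exp.
have S0 t om : (0 <= S t om)%E by exact: trace_exp_ge0.
have [t [M [iS t_cvg0 tM t_cov]]] :=
  exists_weakly_correlated_sequence mS S0 hVar hCov.
pose ES i := fine (\int[P]_v S (t i) v).
pose y i om := fine (S (t i) om) - ES i.
have my i : measurable_fun setT (y i).
  by apply: measurable_funB => //; exact: measurableT_comp.
have y_var i : (\int[P]_w (y i w * y i w)%:E <= M%:E)%E.
  by rewrite -(ecovariance_fine (iS i) (iS i)); exact: tM.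
have y_cov i j : (j < i)%N ->
    (\int[P]_w (y i w * y j w)%:E <= (i.+1%:R^-1)%:E)%E.
  by rewrite -(ecovariance_fine (iS i) (iS j)); exact: t_cov.
pose outer (m : Nsharp_borel (~` B)) i : R :=
  fine (\int[Nsharp_measure m]_(x in ~` B) (expR (- t i * x))%:E)%E.
have cexp i : continuous (fun x : R => expR (- t i * x)).
  move=> x; apply: continuous_comp; last exact: continuous_expR.
  by apply: cvgM; [exact: cvg_cst | exact: cvg_id].
(* An upper limit is defined and measurable on all configurations, whether or not the averages
   converge. *)
pose F (m : Nsharp_borel (~` B)) : R :=
  fine (limn_esup (fun k =>
    (arithmetic_mean (ES \- outer m) (2 ^ k.+1)%N)%:E)).
exists F.
  apply: measurableT_comp => //; apply: measurable_fun_limn_esup => k.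
  apply/measurable_EFinP; apply: measurable_funM => //.
  apply: measurable_sum => i; apply: measurable_funB => //.
  apply: measurableT_comp => //; apply: measurable_Nsharp_integral => //.
  exact: measurableC.
have S_fin : {ae P, forall om, forall i, S (t i) om \is a fin_num}.
  apply: ae_foralln => i; apply: filterS (integrable_ae measurableT (iS i)).
  by move=> om; exact.
have y_cvg := arithmetic_mean_cvg0_ae my y_var y_cov.
have aeP := ae_filter_ringOfSetsType P.
apply: (filterS3 aeP _ hLam S_fin y_cvg) => om [_ _ Lam_cvg] Sfin ycvg.
pose L k := Lam k om.
have L_cvg : L k @[k --> \oo] --> +oo by exact: Lam_cvg.
have [N BN] := eventually_notin_has_ubound L_cvg hB.
rewrite (point_process_bounded_above L_cvg BN); congr EFin.
pose c : R := \sum_(0 <= k < N) \1_B (L k).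
pose inner i : R := \sum_(0 <= k < N) \1_B (L k) * expR (- t i * L k).
pose m := Nsharp_restr (measurableC mB) (point_process L).
(* Finiteness of the trace makes its part outside [B] finite too, so the subtraction takes place
   among reals. *)
have outerE i : outer m i = fine (S (t i) om) - inner i.
  rewrite /outer integral_restr_point_process//; last first.
    exact: continuous_measurable_fun.
  have := Sfin i; rewrite /S (trace_exp_split _ BN) fin_numD => /andP[fo _].
  by rewrite fineD// addrK.
(* [N] does not depend on [i], so the limit is taken term by term, each exponential tending to 1. *)
have inner_cvg : inner i @[i --> \oo] --> c.
  rewrite /inner /c; apply: cvg_big => [|k _]; first exact: add_continuous.
  rewrite -[X in _ --> X]mulr1; apply: cvgM; first exact: cvg_cst.
  rewrite -[X in _ --> X]expR0.
  apply: continuous_cvg; first exact: continuous_expR.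
  rewrite -[X in _ --> X](mul0r (L k)); apply: cvgM; last exact: cvg_cst.
  by rewrite -oppr0; exact: cvgN.
have pow_cvg : (2 ^ k.+1)%N @[k --> \oo] --> \oo.
  move=> A [n _ nA]; exists n => // k nk; apply: nA => /=.
  by rewrite (leq_trans nk)// ltnW// (leq_trans _ (ltn_expl _ _)).
have F_cvg : (arithmetic_mean (ES \- outer m) (2 ^ k.+1)%N)%:E @[k --> \oo]
    --> c%:E.
  apply: cvg_EFin; first exact: nearW.
  (* The random trace cancels, as it enters both [outer m] and [y]. *)
  have -> : ES \- outer m = inner \- y ^~ om.
    by apply/funext => i; rewrite /= outerE /y; ring.
  rewrite (_ : fine \o _ = (fun k => arithmetic_mean inner (2 ^ k.+1)%N -
      arithmetic_mean (y ^~ om) (2 ^ k.+1)%N)); last first.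
    by apply/funext => k; exact: arithmetic_meanB.
  rewrite -(subr0 c); apply: cvgB => //.
  (* The averages of [inner] converge along all indices by Cesàro, in particular along powers of 2;
     those of [y] vanish by [ycvg]. *)
  by apply: (cvg_comp _ _ pow_cvg); exact: cesaro.
by rewrite /F (cvg_limn_einf_sup F_cvg).2.
Qed.
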